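(* Let $\mathcal{G}=(\Omega,E)$ be a graph where $E$ is a reflexive linear ordering. Endow $\Omega$ with the order topology and $E\subseteq\Omega\times\Omega$ with the relative topology of the product topology. Let $\phi=\{\phi(u,v)\}_{(u,v)\in E}$ be a divisible dynamical system on the graph $\mathcal{G}$ consisting of contractions on a Banach space $\mathcal{E}$, and suppose that $\phi$ has geometric growth. Then the following hold. (a) There exist a Banach space $\tilde{\mathcal{E}}$, a strongly continuous divisible dynamical system $\{U(u,v)\}_{(u,v)\in E}$ on the graph $\mathcal{G}$ consisting of surjective isometries on $\tilde{\mathcal{E}}$, a surjective (linear) contraction $j:\tilde{\mathcal{E}}\to\mathcal{E}$ and a linear isometry $r:\mathcal{E}\to\tilde{\mathcal{E}}$ with $j\circ r=\mathbf{I}$, such that $j\,U(u,v)\,r=\phi(u,v)$ for all $(u,v)\in E$. (b) Suppose $\mathcal{E}$ is a unital (resp. commutative unital) C$^*$-algebra $\mathcal{A}$ and $\phi=\{\Phi_{(u,v)}\}_{(u,v)\in E}$ is a family of positive unital linear operators on $\mathcal{A}$. Then there exist a unital (resp. commutative unital) C$^*$-algebra $\tilde{\mathcal{A}}$, a strongly continuous divisible dynamical system $\{U(u,v)\}_{(u,v)\in E}$ on the graph $\mathcal{G}$ consisting of ${}^*$-automorphisms of $\tilde{\mathcal{A}}$, a surjective unital ${}^*$-homomorphism $j:\tilde{\mathcal{A}}\to\mathcal{A}$ and an isometric positive unital linear map $r:\mathcal{A}\to\tilde{\mathcal{A}}$ with $j\circ r=\mathrm{id}_{\mathcal{A}}$,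 such that $j\,U(u,v)\,r=\Phi_{(u,v)}$ for all $(u,v)\in E$.
   Context: A graph $\mathcal{G}=(\Omega,E)$ consists of a non-empty set $\Omega$ of nodes and a non-empty set $E\subseteq\Omega\times\Omega$ of edges. When $E$ is a reflexive linear ordering, write $u\preceq v$ for $(u,v)\in E$ and $\prec$ for its irreflexive part; the order topology on $\Omega$ is generated by the sets $\{u\in\Omega\mid u\prec v\}$ and $\{u\in\Omega\mid v\prec u\}$, $v\in\Omega$. A family $\{\psi(u,v)\}_{(u,v)\in E}$ of bounded operators on a Banach space is a divisible dynamical system on $\mathcal{G}$ if $\psi(u,u)=\mathbf{I}$ for all $u\in\Omega$ with $(u,u)\in E$, and $\psi(u,w)=\psi(u,v)\psi(v,w)$ for all $u,v,w\in\Omega$ with $(u,v),(v,w),(u,w)\in E$. It is strongly continuous if $E\ni(u,v)\mapsto\psi(u,v)$ is continuous with respect to the strong operator topology, i.e. $(u,v)\mapsto\psi(u,v)\xi$ is norm-continuous for each vector $\xi$ of the space. A superadditive length function on $\mathcal{G}$ is a continuous function $\ell:E\to[0,\infty)$ such that $\ell(u,u)=0$ whenever $(u,u)\in E$, and $\ell(u,w)\ge\ell(u,v)+\ell(v,w)$ for all $u,v,w\in\Omega$ with $(u,v),(v,w),(u,w)\in E$. The family $\phi$ has geometric growth if there is a superadditive length function $\ell$ on $\mathcal{G}$ with $\|\phi(u,v)-\mathbf{I}\|\le\ell(u,v)$ for all $(u,v)\in E$. $\mathbf{I}$ denotes the identity operator. A linear map $\Phi$ between C$^*$-algebras is positive if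 it maps positive elements to positive elements, and unital if $\Phi(1)=1$. *)

(* Defs.v *)
From HB Require Import structures.
From mathcomp Require Import all_boot all_order all_algebra.
From mathcomp Require Import complex.
From mathcomp Require Import boolp classical_sets reals.
From mathcomp Require Import topology normedtype.

Set Implicit Arguments.
Unset Strict Implicit.
Unset Printing Implicit Defensive.

Import Order.TTheory GRing.Theory Num.Theory.
Import numFieldNormedType.Exports.

Local Open Scope classical_set_scope.
Local Open Scope ring_scope.

(* [scalar_field re] says that the scalar field K is either the real line R or
   the complex plane R[i], and that [re : K -> R] is the real part.  Norms on a
   [normedModType K] take their values in K; [re] turns them into elements of R
   (no information is lost: a norm is a nonnegative element of K, and
   nonnegative elements of R[i] are real). *)
Inductive scalar_field (R : realType) : forall K : numFieldType, (K -> R) -> Prop :=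
| real_scalars : @scalar_field R R idfun
| complex_scalars : @scalar_field R R[i] (@complex.Re R).

Section Operators.
Context {K : numFieldType} {V W : normedModType K}.
Implicit Type f : V -> W.

Definition bounded_op f := exists M : K, forall x, `|f x| <= M * `|x|.

(* Meaningful for bounded linear f only: [sup] is 0 on unbounded sets. *)
Definition opnorm {R : realType} (re : K -> R) f : R :=
  sup [set re `|f x| | x in [set x : V | `|x| <= 1]].

Definition linear_contraction f := forall x, `|f x| <= `|x|.

Definition norm_preserving f := forall x, `|f x| = `|x|.

Definition surjective_op f := forall y, exists x, f x = y.

End Operators.

(* A graph is given by its edge set E.  Families indexed by E are represented by
   functions of two nodes whose values outside E are irrelevant. *)
Section Graphs.
Context {Omega : topologicalType}.
Variable E : set (Omega * Omega).

Definition is_graph := [set: Omega] !=set0 /\ E !=set0.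

Definition divisible_system {K : numFieldType} {V : normedModType K}
    (psi : Omega -> Omega -> {linear V -> V}) :=
  [/\ forall u v, E (u, v) -> bounded_op (psi u v),
      forall u, E (u, u) -> psi u u =1 id
    & forall u v w, E (u, v) -> E (v, w) -> E (u, w) ->
        psi u w =1 psi u v \o psi v w].

(* {within E, continuous _} is continuity for the relative topology of E. *)
Definition strongly_continuous {K : numFieldType} {V : normedModType K}
    (psi : Omega -> Omega -> {linear V -> V}) :=
  forall xi : V, {within E, continuous (fun p => psi p.1 p.2 xi)}.

Definition superadditive_length {R : realType} (l : Omega -> Omega -> R) :=
  [/\ forall u v, E (u, v) -> 0 <= l u v,
      {within E, continuous (fun p => l p.1 p.2)},
      forall u, E (u, u) -> l u u = 0
    & forall u v w, E (u, v) -> E (v, w) -> E (u, w) ->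
        l u v + l v w <= l u w].

Definition geometric_growth {R : realType} {K : numFieldType} (re : K -> R)
    {V : normedModType K} (phi : Omega -> Omega -> {linear V -> V}) :=
  exists2 l : Omega -> Omega -> R, superadditive_length l &
    forall u v, E (u, v) -> opnorm re (phi u v \- idfun) <= l u v.

End Graphs.

Definition le_edges {d} (Omega : orderTopologicalType d) : set (Omega * Omega) :=
  [set p | (p.1 <= p.2)%O].
Arguments le_edges {d} Omega.

(* Unital C*-algebras, the zero algebra included.  The multiplication and the
   unit are fields of the mixin because Hierarchy Builder rejects a join of
   [NormedModule] with a ring structure ([Num.NumDomain], declared earlier, would
   have to inherit from it). *)
HB.mixin Record isUnitalCStarAlgebra (R : realType) A
    & CompleteNormedModule R[i] A := {
  cmul : A -> A -> A;
  cone : A;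
  star : A -> A;
  cmulA : associative cmul;
  cmul1x : left_id cone cmul;
  cmulx1 : right_id cone cmul;
  cmulDl : left_distributive cmul +%R;
  cmulDr : right_distributive cmul +%R;
  cscaleAl : forall (c : R[i]) (x y : A), c *: cmul x y = cmul (c *: x) y;
  cscaleAr : forall (c : R[i]) (x y : A), c *: cmul x y = cmul x (c *: y);
  starK : involutive star;
  starD : {morph star : x y / x + y};
  starZ : forall (c : R[i]) (x : A), star (c *: x) = c^* *: star x;
  starM : forall x y : A, star (cmul x y) = cmul (star y) (star x);
  cnormM : forall x y : A, `|cmul x y| <= `|x| * `|y|;
  cnorm_star : forall x : A, `|cmul (star x) x| = `|x| ^+ 2
}.

#[short(type="cstarAlgType")]
HB.structure Definition UnitalCStarAlgebra (R : realType) :=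
  {A of CompleteNormedModule R[i] A & isUnitalCStarAlgebra R A}.

Section CStar.
Context {R : realType}.

Definition invertible {A : cstarAlgType R} (a : A) :=
  exists b : A, cmul a b = cone /\ cmul b a = cone.

Definition commutative_algebra (A : cstarAlgType R) :=
  forall a b : A, cmul a b = cmul b a.

Definition spectrum {A : cstarAlgType R} (a : A) : set R[i] :=
  [set z | ~ invertible (z *: cone - a)].

(* In the order of R[i], [0 <= z] means that z is real and nonnegative. *)
Definition positive_element {A : cstarAlgType R} (a : A) :=
  star a = a /\ spectrum a `<=` [set z | 0 <= z].

Context {A B : cstarAlgType R}.
Implicit Type f : {linear A -> B}.

Definition positive_map f :=
  forall a : A, positive_element a -> positive_element (f a).

Definition unital_map f := f cone = cone.

Definition unital_star_homomorphism f :=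
  [/\ unital_map f, {morph f : x y / cmul x y} & {morph f : x / star x}].

End CStar.

Definition star_automorphism {R : realType} {A : cstarAlgType R}
    (f : {linear A -> A}) := bijective f /\ unital_star_homomorphism f.

(* Main.v *)
Require Import Defs.
From HB Require Import structures.
From mathcomp Require Import all_boot all_order all_algebra.
From mathcomp Require Import complex.
From mathcomp Require Import boolp classical_sets functions reals.
From mathcomp Require Import topology normedtype sequences.
From mathcomp Require Import ring lra.

(** Let [G] be the abelian group of finite unions of half-open intervals of
    nodes, under symmetric difference.  The interval [[u, w)] is the sum of [[u, v)] and
    [[v, w)] in [G], so translations by intervals form a divisible system, and on a
    space of bounded [V]-valued functions on [G] with the supremum norm they are
    surjective isometries (involutions, even); on functions with values in a
    C*-algebra they are *-automorphisms for the pointwise operations.  Evaluation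
    at the empty set is [j], and [r] sends [x] to the function whose value at
    [[a1, b1) + ... + [ak, bk)], with [a1 <= b1 <= ... <= bk], is the time-ordered
    product [phi a1 b1 (... (phi ak bk x))].  The value at [[u, v)] being
    [phi u v x], the relation [j (U u v) r = phi u v] is immediate.

    Strong continuity of the translations is imposed by keeping only the functions
    that vary little, uniformly, when an end point of an interval moves
    ([toggle_continuous]); they form a Banach space, and a C*-algebra if [V] is
    one.  Everything thus rests on [r x] being such a function.  Adding [[u, v)] to
    a set affects the time-ordered product only through the pieces of [[u, v)], each
    of which changes it by at most its length; by superadditivity of the length
    function the total change is at most the length of [[u, v)] ([insert_dist]),
    and this is small when [u] and [v] are close.

    Products of unital positive contractions are again such maps, so in the
    C*-algebraic case [r a] is a function with positive values if [a] is positive.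
    It is a positive element because a resolvent of a positive element is bounded
    in terms of the spectral parameter alone ([positive_resolvent_uniform]), so
    that the pointwise resolvents of [r a] are bounded.  Off the real line this is a
    direct consequence of the C*-identity; on the negative half-line it requires
    that the norm of a self-adjoint element is attained on its spectrum, which is
    obtained by repeated squaring ([unit_disc_resolvent]). *)

Set Implicit Arguments.
Unset Strict Implicit.
Unset Printing Implicit Defensive.

Import Order.TTheory GRing.Theory Num.Theory.
Import numFieldNormedType.Exports.

Local Open Scope classical_set_scope.
Local Open Scope ring_scope.

(** * Resolvents of positive elements of a C*-algebra *)

Section CStarBasics.
Context {R : realType} {A : cstarAlgType R}.
Implicit Types (a b c x y : A) (z : R[i]).

(** The norm as an element of [R], where the linear arithmetic tactics apply. *)
Definition rnorm x : R := complex.Re `|x|.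

Lemma rnormE x : `|x| = (rnorm x)%:C%C.
Proof. by rewrite /rnorm RRe_real// ger0_real. Qed.

Lemma rnorm_ge0 x : 0 <= rnorm x.
Proof. by rewrite -ler0c -rnormE. Qed.

Lemma ler_rnormD x y : rnorm (x + y) <= rnorm x + rnorm y.
Proof. by rewrite -lecR rmorphD/= -!rnormE ler_normD. Qed.

Lemma rnormN x : rnorm (- x) = rnorm x.
Proof. by rewrite /rnorm normrN. Qed.

Lemma ler_rnormB x y : rnorm (x - y) <= rnorm x + rnorm y.
Proof. by rewrite -(rnormN y) ler_rnormD. Qed.

Lemma rnormBC x y : rnorm (x - y) = rnorm (y - x).
Proof. by rewrite -rnormN opprB. Qed.

Lemma ler_rnormM x y : rnorm (cmul x y) <= rnorm x * rnorm y.
Proof. by rewrite -lecR rmorphM/= -!rnormE cnormM. Qed.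

Lemma rnormZ z x : rnorm (z *: x) = Normc.normc z * rnorm x.
Proof. by apply: complexI; rewrite -rnormE normrZ rmorphM/= -rnormE. Qed.

Lemma cmulBl x y a : cmul (x - y) a = cmul x a - cmul y a.
Proof.
by rewrite cmulDl -[in LHS]scaleN1r -cscaleAl scaleN1r.
Qed.

Lemma cmulBr x y a : cmul a (x - y) = cmul a x - cmul a y.
Proof.
by rewrite cmulDr -[in LHS]scaleN1r -cscaleAr scaleN1r.
Qed.

Lemma star1 : star cone = cone :> A.
Proof. by rewrite -[LHS]cmulx1 -{2}(starK cone) -starM cmulx1 starK. Qed.

Lemma starB x y : star (x - y) = star x - star y.
Proof. by rewrite starD -[in LHS]scaleN1r starZ rmorphN rmorph1 scaleN1r. Qed.

Lemma rnorm_star_sqr x : rnorm (cmul (star x) x) = rnorm x ^+ 2.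
Proof. by apply: complexI; rewrite -rnormE cnorm_star rnormE rmorphXn. Qed.

Lemma ler_rnorm_star x : rnorm x <= rnorm (star x).
Proof.
have := ler_rnormM (star x) x; rewrite rnorm_star_sqr expr2.
have := rnorm_ge0 x; rewrite le_eqVlt => /predU1P[<- _|x0].
  exact: rnorm_ge0.
by rewrite ler_pM2r.
Qed.

Lemma rnorm_star x : rnorm (star x) = rnorm x.
Proof.
by apply/eqP; rewrite eq_le ler_rnorm_star -{2}(starK x) ler_rnorm_star.
Qed.

Lemma rnorm1_le1 : rnorm (cone : A) <= 1.
Proof.
have := rnorm_star_sqr cone; rewrite star1 cmulx1 => e.
have := rnorm_ge0 cone; rewrite le_eqVlt => /predU1P[<-//|x0].
by rewrite -(ler_pM2l x0) -expr2 -e mulr1.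
Qed.

Definition inverse_pair x a := cmul x a = cone /\ cmul a x = cone.

Lemma inverse_pairC x a : inverse_pair x a -> inverse_pair a x.
Proof. by case. Qed.

Lemma inverse_unique x a b : inverse_pair x a -> inverse_pair x b -> a = b.
Proof.
by move=> [xa ax] [xb bx]; rewrite -[a]cmul1x -bx -cmulA xa cmulx1.
Qed.

Lemma inverseM x y a b :
  inverse_pair x a -> inverse_pair y b -> inverse_pair (cmul x y) (cmul b a).
Proof.
move=> [xa ax] [yb by_]; split.
  by rewrite cmulA -(cmulA x) yb cmulx1.
by rewrite cmulA -(cmulA b) ax cmulx1.
Qed.

Lemma inverseZ z x a : z != 0 ->
  inverse_pair x a -> inverse_pair (z *: x) (z^-1 *: a).
Proof.
move=> z0 [xa ax]; split; rewrite -cscaleAl -cscaleAr scalerA.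
  by rewrite mulfV// xa scale1r.
by rewrite mulVf// ax scale1r.
Qed.

Lemma inverse_star x a : inverse_pair x a -> inverse_pair (star x) (star a).
Proof. by move=> [xa ax]; split; rewrite -starM ?xa ?ax star1. Qed.

(** Applied to two resolvents of the same element, this makes every resolvent
    Lipschitz in its parameter on any set where it is bounded. *)
Lemma resolvent_identity x y a b :
  inverse_pair x a -> inverse_pair y b -> a - b = cmul a (cmul (y - x) b).
Proof.
move=> [_ ax] [yb _].
by rewrite cmulBl cmulBr yb cmulx1 cmulA ax cmul1x.
Qed.

(** The adjoint of [c] is the resolvent at the conjugate of [z], so by the
    resolvent identity [star c - c] is [2 Im z] times [cmul (star c) c], up to a
    factor of modulus [1].  The C*-identity gives the norm of the latter, while
    the norm of [star c - c] is at most [2 * rnorm c]. *)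
Lemma nonreal_resolvent_bound a z c : star a = a ->
  inverse_pair (z *: cone - a) c -> `|complex.Im z| * rnorm c <= 1.
Proof.
move=> sa zc; have := inverse_star zc.
rewrite starB starZ star1 sa => zc'.
have := resolvent_identity zc' zc.
have -> : z *: cone - a - (z^* *: cone - a) = (z - z^*) *: cone.
  by rewrite scalerBl opprB addrA subrK.
rewrite -cscaleAl -cscaleAr cmul1x => e.
have := ler_rnormB (star c) c.
rewrite e rnormZ rnorm_star rnorm_star_sqr.
have -> : Normc.normc (z - z^*) = 2 * `|complex.Im z|.
  case: z {zc zc' e} => u v /=; rewrite subrr opprK expr0n/= add0r sqrtr_sqr.
  by rewrite -mulr2n normrMn mulr_natl.
have := rnorm_ge0 c; rewrite le_eqVlt => /predU1P[<- _|c0].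
  by rewrite mulr0.
rewrite expr2 mulrA -(mulr2n (rnorm c)) -(mulr_natl (rnorm c)) ler_pM2r//.
by rewrite -mulrA ger_pMr.
Qed.

End CStarBasics.

Section DiscBound.
Context {R : realType} {A : cstarAlgType R}.
Implicit Types (a b c w : A) (z : R[i]).
Local Notation normc := (@Normc.normc R).

Lemma normc_ge0 z : 0 <= normc z.
Proof. by case: z => u v; rewrite sqrtr_ge0. Qed.

Lemma normc_le_ReIm z : normc z <= `|complex.Re z| + `|complex.Im z|.
Proof.
case: z => u v /=.
rewrite -(ger0_norm (addr_ge0 (normr_ge0 u) (normr_ge0 v))) -sqrtr_sqr.
rewrite ler_wsqrtr// sqrrD !real_normK ?num_real// addrAC lerDl.
by rewrite mulrn_wge0// mulr_ge0.
Qed.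

(** Factoring out [z] reduces this to the bound at [z^-1], whose imaginary part
    is [- Im z / `|z| ^+ 2]. *)
Lemma nonreal_disc_bound w z c : star w = w -> normc z <= 1 ->
  inverse_pair (cone - z *: w) c -> `|complex.Im z| * rnorm c <= 1.
Proof.
move=> sw z1 zc; have [->|z0] := eqVneq z 0; first by rewrite normr0 mul0r ler01.
have : inverse_pair (z^-1 *: cone - w) (z *: c).
  have := inverseZ (invr_neq0 z0) zc.
  by rewrite invrK scalerBr scalerA mulVf// scale1r.
move=> /(nonreal_resolvent_bound sw); rewrite rnormZ.
have nz0 : 0 < normc z.
  rewrite lt_def normc_ge0 andbT; apply: contraNneq z0 => /eqP.
  by move/eqP/Normc.eq0_normc ->.
have -> : `|complex.Im z^-1| = `|complex.Im z| / normc z ^+ 2.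
  case: z {z0 zc} z1 nz0 => u v /= _ n0.
  have s0 : 0 <= u ^+ 2 + v ^+ 2 by rewrite addr_ge0 ?sqr_ge0.
  rewrite sqr_sqrtr// normrN normrM normfV (ger0_norm s0)//.
rewrite (_ : _ * _ = (`|complex.Im z| * rnorm c) / normc z); last first.
  by field; rewrite gt_eqF.
by rewrite ler_pdivrMr// mul1r => h; exact: le_trans h z1.
Qed.

(** Three regions cover the closed disc: points away from the real axis, where
    the previous bound applies; points away from the unit circle, where
    [c = cone + z *: cmul w c] bounds [c]; and points near [1] or [-1], which are
    perturbations of an invertible element. *)
Lemma disc_bound w : star w = w -> rnorm w <= 1 ->
  (forall z, normc z <= 1 -> exists c, inverse_pair (cone - z *: w) c) ->
  exists2 K : R, 0 < K & forall z c, normc z <= 1 ->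
    inverse_pair (cone - z *: w) c -> rnorm c <= K.
Proof.
move=> sw w1 inv.
have n1 : normc 1 <= 1 by rewrite Normc.normc1.
have nN1 : normc (-1) <= 1 by rewrite /= oppr0 sqrrN expr1n expr0n/= addr0 sqrtr1.
have [p pP] := inv _ n1; have [m mP] := inv _ nN1.
pose K := 1 + rnorm p + rnorm m.
have p0 := rnorm_ge0 p; have m0 := rnorm_ge0 m.
have K1 : 1 <= K by rewrite /K; lra.
have K0 : 0 < K by lra.
(* The strips below have width [1 / (6 * K)], so that the points they leave
   out are at distance at most [3 / (6 * K)] from [1] or [-1]. *)
have near (z0 z : R[i]) a c : inverse_pair (cone - z0 *: w) a -> rnorm a <= K ->
    normc (z0 - z) * (2 * K) <= 1 ->
    inverse_pair (cone - z *: w) c -> rnorm c <= 2 * K.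
  move=> z0a aK zz zc; have e := resolvent_identity zc z0a.
  move: e; have -> : cone - z0 *: w - (cone - z *: w) = (z - z0) *: w.
    by rewrite scalerBl opprB addrC addrA subrK.
  rewrite -cscaleAl -cscaleAr => e.
  have c0 := rnorm_ge0 c.
  have := ler_rnormD (c - a) a; rewrite subrK e rnormZ.
  have -> : normc (z - z0) = normc (z0 - z).
    by rewrite -[in LHS]opprB; case: (z0 - z) => ? ? /=; rewrite !sqrrN.
  have h1 : rnorm (cmul c (cmul w a)) <= rnorm c * K.
    apply: le_trans (ler_rnormM _ _) _; rewrite ler_wpM2l//.
    apply: le_trans (ler_rnormM _ _) _; apply: le_trans aK.
    by rewrite ler_piMl// rnorm_ge0.
  have h2 := ler_wpM2l (normc_ge0 (z0 - z)) h1.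
  have : normc (z0 - z) * (rnorm c * K) <= rnorm c / 2.
    have -> : normc (z0 - z) * (rnorm c * K) =
      (normc (z0 - z) * (2 * K)) * (rnorm c / 2) by field.
    by rewrite ler_piMl// divr_ge0.
  lra.
exists (6 * K) => [|z c z1 zc]; first by lra.
have c0 := rnorm_ge0 c.
have [imz|imz] := leP (1 / (6 * K)) `|complex.Im z|.
  rewrite -[6 * K]invrK -div1r ler_pdivlMr ?invr_gt0; last by lra.
  rewrite mulrC -[_^-1]div1r; apply: le_trans (nonreal_disc_bound sw z1 zc).
  by rewrite ler_wpM2r.
have [small|large] := leP (normc z) (1 - 1 / (6 * K)).
  have e : c = cone + z *: cmul w c.
    by case: zc; rewrite cmulBl cmul1x -cscaleAl => /(canRL (subrK _)).
  have := ler_rnormD cone (z *: cmul w c); rewrite -e rnormZ.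
  have h1 : rnorm (cmul w c) <= rnorm c.
    by apply: le_trans (ler_rnormM _ _) _; rewrite ler_piMl.
  have h2 : normc z * rnorm (cmul w c) <= (1 - 1 / (6 * K)) * rnorm c.
    by apply: ler_pM => //; rewrite ?normc_ge0 ?rnorm_ge0.
  have n11 := @rnorm1_le1 R A => h3.
  have : 1 / (6 * K) * rnorm c <= 1 by lra.
  by rewrite mulrAC mul1r ler_pdivrMr ?mul1r//; lra.
have imz0 := normr_ge0 (complex.Im z).
have large' : 1 - 1 / (6 * K) < `|complex.Re z| + `|complex.Im z|.
  exact: lt_le_trans large (normc_le_ReIm _).
have rez1 : `|complex.Re z| <= 1.
  apply: le_trans z1; case: (z) => u v /=.
  by rewrite -sqrtr_sqr ler_wsqrtr// lerDl sqr_ge0.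
have close (d : R) : d <= 3 / (6 * K) -> d * (2 * K) <= 1.
  move=> dK; rewrite [leRHS](_ : _ = 3 / (6 * K) * (2 * K)).
    by rewrite ler_wpM2r//; lra.
  by field; rewrite gt_eqF.
have [x0|x0] := leP 0 (complex.Re z).
  apply: le_trans (near 1 z p c pP _ _ zc) _; rewrite /K; [lra | | lra].
  apply: close; apply: le_trans (_ : `|1 - complex.Re z| + `|complex.Im z| <= _).
    apply: le_trans (normc_le_ReIm _) _; case: (z) => u v /=.
    by rewrite sub0r normrN.
  by move: large' rez1; rewrite (ger0_norm x0) => ? ?; rewrite ger0_norm; lra.
apply: le_trans (near (-1) z m c mP _ _ zc) _; rewrite /K; [lra | | lra].
apply: close; apply: le_trans (_ : `|- 1 - complex.Re z| + `|complex.Im z| <= _).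
  apply: le_trans (normc_le_ReIm _) _; case: (z) => u v /=.
  by rewrite oppr0 sub0r normrN.
by move: large' rez1; rewrite (ltr0_norm x0) => ? ?; rewrite ler0_norm; lra.
Qed.

End DiscBound.

Section PositiveResolvent.
Context {R : realType} {A : cstarAlgType R}.
Implicit Types (a b c w : A) (z : R[i]).
Local Notation normc := (@Normc.normc R).

Lemma normc_real (x : R) : normc x%:C%C = `|x|.
Proof. by rewrite /= expr0n/= addr0 sqrtr_sqr. Qed.

(** Partial fractions: [1 / (1 - s^2)] is the mean of [1 / (1 - s)] and
    [1 / (1 + s)]. *)
Lemma inverse_average s a b : inverse_pair (cone - s) a ->
  inverse_pair (cone + s) b ->
  inverse_pair (cone - cmul s s : A) (2^-1 *: (a + b)).
Proof.
move=> [sa as_] [sb bs].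
have e1 : cone - cmul s s = cmul (cone + s) (cone - s).
  by rewrite cmulBr cmulx1 cmulDl cmul1x opprD addrA addrK.
have e2 : cone - cmul s s = cmul (cone - s) (cone + s).
  by rewrite cmulDr cmulx1 cmulBl cmul1x addrA subrK.
have two (x : A) : 2^-1 *: (x + x) = x.
  by rewrite -mulr2n -(scaler_nat _ x) scalerA mulVf ?pnatr_eq0// scale1r.
have sum : cone + s + (cone - s) = cone + cone :> A by rewrite addrACA subrr addr0.
split.
  rewrite -cscaleAr cmulDr {1}e1 {1}e2 -!cmulA sa sb !cmulx1 sum.
  exact: two.
rewrite -cscaleAl cmulDl {1}e2 {1}e1 !cmulA as_ bs !cmul1x sum.
exact: two.
Qed.

(** Radial continuity of the resolvent up to the unit circle, in a form that
    survives the squaring of [w]. *)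
Definition close_resolvents w (r e : R) := forall z, normc z <= 1 ->
  exists a b, [/\ inverse_pair (cone - z *: w) a,
    inverse_pair (cone - (r%:C%C * z) *: w) b & rnorm (a - b) <= e].

(** Averaging over the two square roots of [z] does not increase [e]. *)
Lemma close_resolvents_sqr w r e :
  close_resolvents w r e -> close_resolvents (cmul w w) (r ^+ 2) e.
Proof.
move=> h z z1; pose y := sqrtc z.
have yy : y * y = z by rewrite -expr2 sqr_sqrtc.
have y1 : normc y <= 1.
  by rewrite -(expr_le1 (n := 2))// ?normc_ge0// expr2 -Normc.normcM yy.
have yN1 : normc (- y) <= 1 by case: (y) y1 => u v /=; rewrite !sqrrN.
have [a [b [ya yb ab]]] := h _ y1.
have [c [d [yc yd cd]]] := h _ yN1.
exists (2^-1 *: (a + c)), (2^-1 *: (b + d)); split.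
- have -> : z *: cmul w w = cmul (y *: w) (y *: w).
    by rewrite -cscaleAl -cscaleAr scalerA yy.
  by apply: inverse_average => //; move: yc; rewrite scaleNr opprK.
- have -> : ((r ^+ 2)%:C%C * z) *: cmul w w =
      cmul ((r%:C%C * y) *: w) ((r%:C%C * y) *: w).
    by rewrite -cscaleAl -cscaleAr scalerA mulrACA yy rmorphXn.
  apply: inverse_average => //.
  by move: yd; rewrite mulrN scaleNr opprK.
rewrite -scalerBr opprD addrACA rnormZ.
have -> : normc (2^-1) = 2^-1.
  have -> : 2^-1 = (2^-1)%:C%C :> R[i] by rewrite fmorphV rmorph_nat.
  by rewrite normc_real ger0_norm ?invr_ge0.
have := ler_rnormD (a - b) (c - d); lra.
Qed.

Lemma close_resolvents_initial w e : star w = w -> rnorm w <= 1 -> 0 < e ->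
  (forall z, normc z <= 1 -> exists c, inverse_pair (cone - z *: w) c) ->
  exists2 r : R, 0 <= r < 1 & close_resolvents w r e.
Proof.
move=> sw w1 e0 inv; have [K K0 KP] := disc_bound sw w1 inv.
pose d := e / (e + K ^+ 2).
have eK : 0 < e + K ^+ 2 by rewrite addr_gt0// exprn_gt0.
have d0 : 0 < d by rewrite divr_gt0.
have d1 : d <= 1 by rewrite ler_pdivrMr// mul1r lerDl sqr_ge0.
have r01 : 0 <= 1 - d < 1 by apply/andP; split; lra.
exists (1 - d) => // z z1.
have rz1 : normc ((1 - d)%:C%C * z) <= 1.
  rewrite Normc.normcM normc_real ger0_norm; last by lra.
  by apply: mulr_ile1 => //; rewrite ?normc_ge0//; lra.
have [a za] := inv _ z1; have [b zb] := inv _ rz1.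
exists a, b; split=> //.
rewrite (resolvent_identity za zb).
have -> : cone - ((1 - d)%:C%C * z) *: w - (cone - z *: w) = (d%:C%C * z) *: w.
  rewrite opprB addrC -addrA [X in _ + X]addrA addNr add0r -scalerBl.
  by rewrite rmorphB/= rmorph1 mulrBl mul1r opprB addrC subrK.
rewrite -cscaleAl -cscaleAr rnormZ.
have n1 : normc (d%:C%C * z) <= d.
  rewrite Normc.normcM normc_real ger0_norm; last by lra.
  by rewrite ler_piMr//; lra.
have n2 : rnorm (cmul a (cmul w b)) <= K * K.
  apply: le_trans (ler_rnormM _ _) _; apply: ler_pM; rewrite ?rnorm_ge0//.
    exact: KP za.
  apply: le_trans (ler_rnormM _ _) _.
  apply: le_trans (_ : rnorm b <= _); first by rewrite ler_piMl// rnorm_ge0.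
  exact: KP zb.
apply: le_trans (ler_pM _ _ n1 n2) _; rewrite ?normc_ge0 ?rnorm_ge0//.
rewrite /d mulrAC ler_pdivrMr// -expr2 ler_wpM2l//; first exact: ltW.
by rewrite lerDr ltW.
Qed.

(** A self-adjoint element of norm [1] has a spectral value of modulus at
    least [1].  Suppose not, and square repeatedly: [u := w ^ (2 ^ n)] still has
    norm [1] by the C*-identity, and [(1 - u)^-1] stays [12^-1]-close to
    [(1 - p u)^-1], where [p := r ^ (2 ^ n)] is as small as desired.  The latter
    is then close to [1], so [u = ((1 - u)^-1 - 1) (1 - u)] is too small to have
    norm [1].  Using only square roots, this replaces the complex analysis or the
    roots of unity of all orders in the usual proofs of the spectral radius
    formula. *)
Lemma unit_disc_resolvent w : star w = w -> rnorm w = 1 ->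
  ~ (forall z, normc z <= 1 -> exists c, inverse_pair (cone - z *: w) c).
Proof.
move=> sw w1 inv.
have e0 : 0 < 12^-1 :> R by rewrite invr_gt0.
have w1' : rnorm w <= 1 by rewrite w1.
have [r /andP[r0 r1] clo] := close_resolvents_initial sw w1' e0 inv.
have [n rn] : exists n, r ^+ n < 4^-1.
  have : (fun n => r ^+ n) @ \oo --> (0 : R).
    by apply: cvg_expr; rewrite ger0_norm.
  move=> /cvgrPdist_lt/(_ 4^-1); rewrite invr_gt0 => /(_ (ltr0Sn _ _)).
  move=> [n _ /(_ n (leqnn n))]/=; rewrite sub0r normrN ger0_norm ?exprn_ge0//.
  by exists n.
pose u k := iter k (fun x : A => cmul x x) w.
have su k : star (u k) = u k by elim: k => //= k IH; rewrite starM IH.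
have u1 k : rnorm (u k) = 1.
  by elim: k => //= k IH; rewrite -{1}su rnorm_star_sqr IH expr1n.
have cu k : close_resolvents (u k) (r ^+ (2 ^ k)) 12^-1.
  elim: k => //= k IH; rewrite expnSr exprM; exact: close_resolvents_sqr.
pose p := r ^+ (2 ^ n).
have p0 : 0 <= p by rewrite exprn_ge0.
have p4 : p <= 4^-1.
  apply: le_trans (ltW rn); apply: ler_wiXn2l => //; first exact: ltW.
  exact/ltnW/ltn_expl.
have [|a [b []]] := cu n 1; first by rewrite Normc.normc1.
rewrite scale1r mulr1 -/p => [[ua au] [ub bu] ab].
have b0 := rnorm_ge0 b; have n1 := @rnorm1_le1 R A.
have eb : b - cone = p%:C%C *: cmul (u n) b.
  by rewrite -ub cmulBl cmul1x -cscaleAl opprB addrC subrK.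
have hb : rnorm (b - cone) <= p * rnorm b.
  rewrite eb rnormZ normc_real ger0_norm// ler_wpM2l//.
  by apply: le_trans (ler_rnormM _ _) _; rewrite u1 mul1r.
have hb' : p * rnorm b <= 4^-1 * rnorm b by rewrite ler_wpM2r.
have := ler_rnormD (b - cone) cone; rewrite subrK => hb2.
have := ler_rnormD (a - b) (b - cone); rewrite addrA subrK => ha.
have eu : u n = cmul (a - cone) (cone - u n).
  by rewrite cmulBl au cmul1x opprB addrC subrK.
have := ler_rnormM (a - cone) (cone - u n); rewrite -eu u1 => hu.
have := ler_rnormB cone (u n); rewrite u1 => hu2.
have : rnorm (a - cone) * rnorm (cone - u n) <= 5/12 * 2.
  by apply: ler_pM; rewrite ?rnorm_ge0//; lra.
lra.
Qed.

(** The spectral values of [c = (t + a)^-1] are at most [1 / t].  If the norm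
    [N] of [c] exceeded [1 / t], then [N^-1 c] would be self-adjoint of norm [1]
    and [1 - (z / N) c = c (t - z / N + a)] would be invertible for all [z] in the
    unit disc, since [t - z / N] then has positive real part. *)
Lemma positive_resolvent_bound a t c : positive_element a -> 0 < t ->
  inverse_pair (t%:C%C *: cone + a) c -> t * rnorm c <= 1.
Proof.
move=> [sa spec] t0 tc; rewrite leNgt; apply/negP => tc1.
have c0 : 0 < rnorm c by rewrite -(pmulr_rgt0 _ t0) (lt_trans ltr01).
pose N := rnorm c; pose w : A := (N^-1)%:C%C *: c.
have sc : star c = c.
  apply: (inverse_unique _ tc); have := inverse_star tc.
  rewrite starD starZ star1 sa.
  by have -> : (t%:C%C)^* = t%:C%C by exact: conjc_real.
have sw : star w = w.
  rewrite starZ sc.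
  by have -> : (N^-1)%:C%C^* = (N^-1)%:C%C by exact: conjc_real.
have w1 : rnorm w = 1.
  rewrite rnormZ normc_real ger0_norm ?invr_ge0 ?ltW//.
  by rewrite mulVf// gt_eqF.
apply: (unit_disc_resolvent sw w1) => z z1.
pose y := z * (N^-1)%:C%C.
have : invertible ((y - t%:C%C) *: cone - a).
  apply: contrapT => /spec /=.
  rewrite lecE/= => /andP[_].
  have : complex.Re y < t.
    apply: le_lt_trans (ler_norm _) _.
    apply: le_lt_trans (_ : normc y < t).
      by case: (y) => u v /=; rewrite -sqrtr_sqr ler_wsqrtr// lerDl sqr_ge0.
    rewrite Normc.normcM normc_real ger0_norm ?invr_ge0 ?ltW//.
    rewrite ltr_pdivrMr//; exact: le_lt_trans z1 tc1.
  by rewrite raddfB /=; lra.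
move=> [d yd].
have yd' : inverse_pair (t%:C%C *: cone + a - y *: cone) (- d).
  have := inverseZ (_ : -1 != 0 :> R[i]) yd; rewrite invrN invr1 !scaleN1r.
  rewrite opprB scalerBl opprB addrA [a + _]addrC; apply.
  by rewrite oppr_eq0 oner_eq0.
have := inverseM (inverse_pairC tc) yd'.
have -> : cmul c (t%:C%C *: cone + a - y *: cone) = cone - z *: w.
  by rewrite cmulBr; case: tc => _ ->; rewrite -cscaleAr cmulx1 scalerA.
by move=> h; eexists; exact: h.
Qed.

(** What matters is that the bound does not depend on [a]: it makes pointwise
    inverses of a function with positive values bounded. *)
Lemma positive_resolvent_uniform z : ~~ (0 <= z) ->
  exists M : R, forall a c, positive_element a ->
    inverse_pair (z *: cone - a) c -> rnorm c <= M.
Proof.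
move=> z0; have [im0|im0] := eqVneq (complex.Im z) 0.
  have re0 : complex.Re z < 0 by move: z0; rewrite lecE/= im0 eqxx/= -ltNge.
  exists (- complex.Re z)^-1 => a c pa zc.
  have m0 : 0 < - complex.Re z by rewrite oppr_gt0.
  rewrite -[leRHS]mul1r ler_pdivlMr// mulrC -rnormN.
  apply: positive_resolvent_bound pa m0 _.
  have := inverseZ (_ : -1 != 0 :> R[i]) zc; rewrite invrN invr1 !scaleN1r.
  rewrite opprB addrC -scaleNr (_ : - z = (- complex.Re z)%:C%C).
    by apply; rewrite oppr_eq0 oner_eq0.
  by case: (z) im0 => u v /= ->; apply/eqP; rewrite eq_complex /= oppr0 !eqxx.
exists (`|complex.Im z|)^-1 => a c [sa _] zc.
rewrite -[leRHS]mul1r ler_pdivlMr ?normr_gt0// mulrC.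
exact: nonreal_resolvent_bound zc.
Qed.

End PositiveResolvent.

(** * The Banach space of parity functions *)

(** Norms take values in [K] but suprema exist only in [R]; this is what is needed
    to pass between the two, for [K] the real or the complex field. *)
Record real_scalars (R : realType) (K : numFieldType) := RealScalars {
  rpart : K -> R;
  remb : R -> K;
  rpart_le : {homo rpart : x y / x <= y};
  remb_le : {homo remb : x y / x <= y};
  rpartK : forall x, 0 <= x -> remb (rpart x) = x;
  rembD : {morph remb : x y / x + y} }.

Section ParityFunctions.
Context {K : numFieldType} {V : normedModType K} {T : topologicalType}.
Implicit Types (f g : seq T -> V) (s t : seq T) (u v : T).

Definition bounded_fun f := exists M : K, forall s, `|f s| <= M.

(** A sequence [s] stands for the set of nodes having an odd number of entries
    of [s] at or below them, a finite union of half-open intervals, the last one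
    unbounded if [size s] is odd; functions with this invariance depend on that
    set only.  Prepending [u] and [v] to [s] takes the symmetric difference with
    the interval between [u] and [v]. *)
Definition parity_invariant f := (forall s t, perm_eq s t -> f s = f t) /\
  (forall u s, f [:: u, u & s] = f s).

(** This makes translation by a short interval nearly trivial, uniformly; a single
    end point suffices because [parity_invariant] makes all of them equivalent. *)
Definition toggle_continuous f := forall u (e : K), 0 < e ->
  \forall v \near u, forall s, `|f (v :: s) - f (u :: s)| <= e.

Definition admissible : {pred seq T -> V} := fun f =>
  `[< [/\ bounded_fun f, parity_invariant f & toggle_continuous f] >].

Lemma admissibleP f : reflect
  [/\ bounded_fun f, parity_invariant f & toggle_continuous f] (f \in admissible).
Proof. exact: asboolP. Qed.

Lemma admissible_submod : submod_closed admissible.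
Proof.
split.
  apply/admissibleP; split=> [||u e e0].
  - by exists 0 => s; rewrite normr0.
  - by split.
  - by apply: nearW => v s; rewrite subrr normr0 ltW.
move=> a f g /admissibleP[[M fM] [fp fc] fT] /admissibleP[[N gN] [gp gc] gT].
apply/admissibleP; split=> [||u e e0].
- exists (`|a| * M + N) => s; apply: le_trans (ler_normD _ _) _.
  by rewrite lerD// normrZ ler_wpM2l.
- split=> [s t st|u s] /=; first by congr (_ *: _ + _); [exact: fp|exact: gp].
  by congr (_ *: _ + _); [exact: fc|exact: gc].
- have c0 : 0 < `|a| + 1 by rewrite ltr_wpDl.
  have e1 : 0 < e / 2 / (`|a| + 1) by rewrite !divr_gt0.
  have e2 : 0 < e / 2 by rewrite divr_gt0.
  have := fT u _ e1; have := gT u _ e2; apply: filterS2 => v gv fv s.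
  have -> : (a *: f + g) (v :: s) - (a *: f + g) (u :: s) =
      a *: (f (v :: s) - f (u :: s)) + (g (v :: s) - g (u :: s)).
    by rewrite scalerBr addrACA -opprD.
  apply: le_trans (ler_normD _ _) _.
  rewrite [e]splitr lerD// normrZ.
  apply: le_trans (ler_wpM2l (normr_ge0 _) (fv s)) _.
  rewrite mulrCA ger_pMr// ler_pdivrMr// mul1r lerDl; exact: ler01.
Qed.

End ParityFunctions.
Arguments admissible {K} V T.

HB.instance Definition _ (K : numFieldType) (V : normedModType K)
    (T : topologicalType) :=
  GRing.isSubmodClosed.Build K (seq T -> V) (admissible V T)
    (@admissible_submod K V T).

(** The parameter [S] determines the norm. *)
Record dilation {R : realType} {K : numFieldType} (S : real_scalars R K)
  (V : completeNormedModType K) (T : topologicalType) := Dilation {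
  dilation_fun :> seq T -> V;
  dilation_admissible : dilation_fun \in admissible V T }.

HB.instance Definition _ (R : realType) (K : numFieldType)
    (S : real_scalars R K) (V : completeNormedModType K)
    (T : topologicalType) := [isSub for @dilation_fun R K S V T].
HB.instance Definition _ (R : realType) (K : numFieldType)
    (S : real_scalars R K) (V : completeNormedModType K)
    (T : topologicalType) := [Choice of dilation S V T by <:].
HB.instance Definition _ (R : realType) (K : numFieldType)
    (S : real_scalars R K) (V : completeNormedModType K)
    (T : topologicalType) := [SubChoice_isSubLmodule of dilation S V T by <:].

Section SupNorm.
Context {R : realType} {K : numFieldType} {S : real_scalars R K}
  {V : completeNormedModType K} {T : topologicalType}.
Implicit Types (f g : dilation S V T).

Lemma dilationP f : [/\ bounded_fun f, parity_invariant f & toggle_continuous f].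
Proof. by case: f => f af; apply/admissibleP. Qed.

Lemma dilation_ext f g : f =1 g -> f = g.
Proof. by move=> fg; apply: val_inj; apply: funext. Qed.

Definition sup_norm f : K := remb S (sup [set rpart S `|f s| | s in setT]).

Lemma ler_sup_norm f s : `|f s| <= sup_norm f.
Proof.
rewrite -(rpartK S (normr_ge0 (f s))); apply: remb_le.
apply: ub_le_sup; last by exists s.
have [[M fM] _ _] := dilationP f; exists (rpart S M) => _ [t _ <-].
exact/rpart_le/fM.
Qed.

Lemma sup_norm_le f (M : K) : (forall s, `|f s| <= M) -> sup_norm f <= M.
Proof.
move=> fM; have M0 : 0 <= M by apply: le_trans (fM [::]).
rewrite -(rpartK S M0); apply: remb_le; apply: ge_sup.
  by exists (rpart S `|f [::]|), [::].
by move=> _ [s _ <-]; exact/rpart_le/fM.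
Qed.

Lemma sup_norm_ge0 f : 0 <= sup_norm f.
Proof. exact: le_trans (ler_sup_norm f [::]). Qed.

Lemma ler_sup_normD f g : sup_norm (f + g) <= sup_norm f + sup_norm g.
Proof.
apply: sup_norm_le => s; apply: le_trans (ler_normD _ _) _.
by rewrite lerD// ler_sup_norm.
Qed.

Lemma sup_normZ (a : K) f : sup_norm (a *: f) = `|a| * sup_norm f.
Proof.
have le (b : K) g : sup_norm (b *: g) <= `|b| * sup_norm g.
  apply: sup_norm_le => s; rewrite [X in X <= _]normrZ.
  by rewrite ler_wpM2l// ler_sup_norm.
have [->|a0] := eqVneq a 0.
  apply/eqP; rewrite eq_le; apply/andP; split; first exact: le.
  by rewrite normr0 mul0r sup_norm_ge0.
apply/eqP; rewrite eq_le le/= -ler_pdivlMl ?normr_gt0//.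
by rewrite -normfV -[f in X in X <= _]scale1r -(mulVf a0) -scalerA le.
Qed.

Lemma sup_norm_eq0 f : sup_norm f = 0 -> f = 0.
Proof.
move=> f0; apply: dilation_ext => s; apply/eqP.
by rewrite -normr_le0 -f0 ler_sup_norm.
Qed.

End SupNorm.

HB.instance Definition _ (R : realType) (K : numFieldType)
    (S : real_scalars R K) (V : completeNormedModType K)
    (T : topologicalType) :=
  Lmodule_isNormed.Build K (dilation S V T) (@ler_sup_normD R K S V T)
    (@sup_normZ R K S V T) (@sup_norm_eq0 R K S V T).

Section Completeness.
Context {R : realType} {K : numFieldType} {S : real_scalars R K}
  {V : completeNormedModType K} {T : topologicalType}.
Implicit Types (f g : dilation S V T).

Lemma dilation_norm_le f s : `|f s| <= `|f|.
Proof. exact: ler_sup_norm. Qed.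

Lemma dilation_le_norm f (M : K) : (forall s, `|f s| <= M) -> `|f| <= M.
Proof. exact: sup_norm_le. Qed.

(** Admissibility passes to uniform limits, so it suffices to take the pointwise
    limit and check that it is uniform. *)
Lemma dilation_complete (F : set_system (dilation S V T)) :
  ProperFilter F -> cauchy F -> cvg F.
Proof.
move=> FF /cauchy_ballP Fc.
have FFc (e : K) : 0 < e -> \forall f \near F, \forall h \near F, `|f - h| < e.
  move=> e0; have := Fc e e0 => /nearP_dep; apply: filterS => f.
  by apply: filterS => h; rewrite -ball_normE.
pose ev s := (fun f : dilation S V T => f s) @ F.
have evc s : cvg (ev s).
  apply: cauchy_cvg; apply/cauchy_exP => e e0.
  have := FFc e e0 => /filter_ex[f fh].
  exists (f s); apply: filterS fh => h /= fh.
  rewrite -ball_normE /=; apply: le_lt_trans fh.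
  exact: (dilation_norm_le (f - h)).
pose g s : V := lim (ev s).
have unif (e : K) : 0 < e -> \forall f \near F,
    forall s, `|g s - @dilation_fun _ _ S V T f s| <= e.
  move=> e0; have e2 : 0 < e / 2 by rewrite divr_gt0.
  have := FFc _ e2; apply: filterS => f fh s.
  have gs : \forall h \near F, `|g s - @dilation_fun _ _ S V T h s| < e / 2.
    by have /cvgrPdist_lt/(_ _ e2) := evc s.
  have [h [h1 h2]] := filter_ex (filterI fh gs).
  rewrite -(subrK (h s) (g s)) -addrA [e]splitr.
  apply: le_trans (ler_normD _ _) _; rewrite lerD//; first exact: ltW.
  rewrite distrC; apply: le_trans (ltW h1); exact: (dilation_norm_le (f - h)).
have gadm : g \in admissible V T.
  apply/admissibleP; split=> [||u e e0].
  - have [f fg] := filter_ex (unif 1 ltr01); exists (1 + `|f|) => s.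
    rewrite -(subrK (f s) (g s)); apply: le_trans (ler_normD _ _) _.
    by rewrite lerD// dilation_norm_le.
  - split=> [s t st|u s]; rewrite /g; congr (lim _); congr (_ @ F);
      apply/funext => f; have [_ [fp fc] _] := dilationP f.
      exact: fp.
    exact: fc.
  - have e3 : 0 < e / 3 by rewrite divr_gt0.
    have [f fg] := filter_ex (unif _ e3).
    have [_ _ fT] := dilationP f.
    have := fT u _ e3; apply: filterS => v fv s.
    have -> : g (v :: s) - g (u :: s) = (g (v :: s) - f (v :: s)) +
        (f (v :: s) - f (u :: s)) + (f (u :: s) - g (u :: s)).
      by rewrite (addrA (g _ - _)) subrK addrA subrK.
    have -> : e = e / 3 + e / 3 + e / 3 by field.
    apply: le_trans (ler_normD _ _) _; apply: lerD; last by rewrite distrC.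
    by apply: le_trans (ler_normD _ _) _; apply: lerD.
apply/cvg_ex; exists (Dilation S gadm); apply/cvgrPdist_le => e e0.
by have := unif e e0; apply: filterS => f fg; apply: dilation_le_norm.
Qed.

End Completeness.

HB.instance Definition _ (R : realType) (K : numFieldType)
    (S : real_scalars R K) (V : completeNormedModType K)
    (T : topologicalType) :=
  Uniform_isComplete.Build (dilation S V T) (@dilation_complete R K S V T).

(** * The flips *)

Section Flip.
Context {R : realType} {K : numFieldType} {S : real_scalars R K}
  {V : completeNormedModType K} {T : topologicalType}.
Implicit Types (f g : dilation S V T) (u v w : T) (s t : seq T).

Lemma dilation_perm f s t : perm_eq s t -> f s = f t.
Proof. by have [_ [fp _] _] := dilationP f => /fp. Qed.

Lemma dilation_cancel f u s : f [:: u, u & s] = f s.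
Proof. by have [_ [_ fc] _] := dilationP f. Qed.

Lemma dilation_swap f u v s : f [:: u, v & s] = f [:: v, u & s].
Proof. by apply: dilation_perm; apply/permEl/(perm_catCA [:: u] [:: v] s). Qed.

Lemma dilation_cont f u (e : K) : 0 < e ->
  \forall v \near u, forall s, `|f (v :: s) - f (u :: s)| <= e.
Proof. by have [_ _ fT] := dilationP f; exact: fT. Qed.

Lemma flip_admissible u v f : (fun s => f [:: u, v & s]) \in admissible V T.
Proof.
apply/admissibleP; split=> [||w e e0].
- by exists `|f| => s; exact: dilation_norm_le.
- split=> [s t st|w s]; first by apply: dilation_perm; rewrite !perm_cons.
  rewrite -[RHS](dilation_cancel _ w); apply: dilation_perm.
  exact/permEl/(perm_catCA [:: u; v] [:: w; w] s).
- have := dilation_cont f w e0; apply: filterS => w' fw s.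
  have h x : f [:: u, v, x & s] = f [:: x, u, v & s].
    by apply: dilation_perm; apply/permEl/(perm_catCA [:: u; v] [:: x] s).
  by rewrite !h.
Qed.

(** Translation by an interval in the group of finite unions of intervals under
    symmetric difference. *)
Definition flip u v f : dilation S V T := Dilation S (flip_admissible u v f).

Lemma flip_is_linear u v : linear (flip u v).
Proof. by move=> a f g; exact: dilation_ext. Qed.

HB.instance Definition _ u v := GRing.isLinear.Build K (dilation S V T)
  (dilation S V T) *:%R (flip u v) (flip_is_linear u v).

Lemma flip_id u f : flip u u f = f.
Proof. by apply: dilation_ext => s; exact: dilation_cancel. Qed.

(** The symmetric difference of [[u, v)] and [[v, w)] is [[u, w)]. *)
Lemma flip_comp u v w f : flip u w f = flip u v (flip v w f).
Proof.
apply: dilation_ext => s /=; rewrite -(dilation_cancel f v [:: u, w & s]).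
by apply: dilation_perm; apply/permP => p /=; ring.
Qed.

Lemma flip_involutive u v : involutive (flip u v).
Proof.
move=> f; apply: dilation_ext => s /=.
rewrite -[RHS](dilation_cancel f u) -[RHS](dilation_cancel f v).
by apply: dilation_perm; apply/permP => p /=; ring.
Qed.

Lemma flip_norm u v f : `|flip u v f| = `|f|.
Proof.
have le g : `|flip u v g| <= `|g|.
  by apply: dilation_le_norm => s; exact: (dilation_norm_le g [:: u, v & s]).
by apply/eqP; rewrite eq_le le -[f in leLHS](flip_involutive u v) le.
Qed.

(** The two end points are moved one after the other. *)
Lemma flip_strongly_continuous (E : set (T * T)) :
  strongly_continuous E (fun u v => flip u v : {linear _ -> _}).
Proof.
move=> f; apply: continuous_subspaceT => -[u v] /=.
apply/cvgrPdist_le => e e0.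
have e2 : 0 < e / 2 by rewrite divr_gt0.
exists ([set u' | forall s, `|f (u' :: s) - f (u :: s)| <= e / 2],
        [set v' | forall s, `|f (v' :: s) - f (v :: s)| <= e / 2]) => /=.
  by split; exact: dilation_cont.
move=> [u' v'] [/= hu hv]; apply: dilation_le_norm => s.
have -> : (flip u v f - flip u' v' f) s =
    (f [:: v, u & s] - f [:: v', u & s]) + (f [:: u, v' & s] - f [:: u', v' & s]).
  by rewrite (dilation_swap f v') addrA subrK (dilation_swap f v).
rewrite [e]splitr; apply: le_trans (ler_normD _ _) _.
by apply: lerD; rewrite distrC.
Qed.

Definition eval0 f : V := f [::].

Lemma eval0_is_linear : linear eval0.
Proof. by []. Qed.

HB.instance Definition _ := GRing.isLinear.Build K (dilation S V T)
  V *:%R eval0 eval0_is_linear.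

End Flip.

(** * The pointwise C*-algebra structure *)

Section PointwiseAlgebra.
Context {R : realType} {S : real_scalars R R[i]}
  {A : cstarAlgType R} {T : topologicalType}.
Implicit Types (f g h : dilation S A T).

Lemma pointwise_mul_admissible f g :
  (fun s => cmul (f s) (g s)) \in admissible A T.
Proof.
have fgM s t : `|cmul (f s) (g t)| <= `|f| * `|g|.
  apply: le_trans (cnormM _ _) _.
  by apply: ler_pM => //; exact: dilation_norm_le.
apply/admissibleP; split=> [||u e e0].
- by exists (`|f| * `|g|).
- split=> [s t st|u s].
    by rewrite (dilation_perm f st) (dilation_perm g st).
  by rewrite !dilation_cancel.
- have c0 : 0 < `|f| + `|g| + 1 by rewrite ltr_wpDl// addr_ge0.
  have e1 : 0 < e / (`|f| + `|g| + 1) by rewrite divr_gt0.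
  have := dilation_cont f u e1; have := dilation_cont g u e1.
  apply: filterS2 => v gv fv s.
  have -> : cmul (f (v :: s)) (g (v :: s)) - cmul (f (u :: s)) (g (u :: s)) =
      cmul (f (v :: s)) (g (v :: s) - g (u :: s)) +
      cmul (f (v :: s) - f (u :: s)) (g (u :: s)).
    by rewrite cmulBr cmulBl addrA subrK.
  have h1 : `|cmul (f (v :: s)) (g (v :: s) - g (u :: s))| <=
      `|f| * (e / (`|f| + `|g| + 1)).
    apply: le_trans (cnormM _ _) _; apply: ler_pM => //.
    exact: dilation_norm_le.
  have h2 : `|cmul (f (v :: s) - f (u :: s)) (g (u :: s))| <=
      (e / (`|f| + `|g| + 1)) * `|g|.
    apply: le_trans (cnormM _ _) _; apply: ler_pM => //.
    exact: dilation_norm_le.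
  apply: le_trans (ler_normD _ _) _; apply: le_trans (lerD h1 h2) _.
  rewrite [X in X + _]mulrC -mulrDr mulrAC ler_pdivrMr// ler_wpM2l//.
    exact: ltW.
  by rewrite lerDl.
Qed.

Lemma pointwise_star_admissible f : (fun s => star (f s)) \in admissible A T.
Proof.
have nstar (a : A) : `|star a| = `|a| by rewrite !rnormE rnorm_star.
apply/admissibleP; split=> [||u e e0].
- by exists `|f| => s; rewrite nstar dilation_norm_le.
- split=> [s t st|u s]; first by rewrite (dilation_perm f st).
  by rewrite dilation_cancel.
- have := dilation_cont f u e0; apply: filterS => v fv s.
  by rewrite -starB nstar.
Qed.

Lemma constant_admissible (a : A) : (fun=> a) \in admissible A T.
Proof.
apply/admissibleP; split=> [||u e e0]; [by exists `|a| | by [] |].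
by apply: nearW => v s; rewrite subrr normr0 ltW.
Qed.

Definition pointwise_mul f g : dilation S A T :=
  Dilation S (pointwise_mul_admissible f g).
Definition pointwise_star f : dilation S A T :=
  Dilation S (pointwise_star_admissible f).
Definition pointwise_one : dilation S A T :=
  Dilation S (constant_admissible cone).

Lemma pointwise_mulA : associative pointwise_mul.
Proof. by move=> f g h; apply: dilation_ext => s; exact: cmulA. Qed.
Lemma pointwise_mul1x : left_id pointwise_one pointwise_mul.
Proof. by move=> f; apply: dilation_ext => s; exact: cmul1x. Qed.
Lemma pointwise_mulx1 : right_id pointwise_one pointwise_mul.
Proof. by move=> f; apply: dilation_ext => s; exact: cmulx1. Qed.
Lemma pointwise_mulDl : left_distributive pointwise_mul +%R.
Proof. by move=> f g h; apply: dilation_ext => s; exact: cmulDl. Qed.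
Lemma pointwise_mulDr : right_distributive pointwise_mul +%R.
Proof. by move=> f g h; apply: dilation_ext => s; exact: cmulDr. Qed.
Lemma pointwise_scaleAl (c : R[i]) f g :
  c *: pointwise_mul f g = pointwise_mul (c *: f) g.
Proof. by apply: dilation_ext => s; exact: cscaleAl. Qed.
Lemma pointwise_scaleAr (c : R[i]) f g :
  c *: pointwise_mul f g = pointwise_mul f (c *: g).
Proof. by apply: dilation_ext => s; exact: cscaleAr. Qed.
Lemma pointwise_starK : involutive pointwise_star.
Proof. by move=> f; apply: dilation_ext => s; exact: starK. Qed.
Lemma pointwise_starD : {morph pointwise_star : f g / f + g}.
Proof. by move=> f g; apply: dilation_ext => s; exact: starD. Qed.
Lemma pointwise_starZ (c : R[i]) f :
  pointwise_star (c *: f) = c^* *: pointwise_star f.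
Proof. by apply: dilation_ext => s; exact: starZ. Qed.
Lemma pointwise_starM f g :
  pointwise_star (pointwise_mul f g) =
  pointwise_mul (pointwise_star g) (pointwise_star f).
Proof. by apply: dilation_ext => s; exact: starM. Qed.

Lemma pointwise_normM f g : `|pointwise_mul f g| <= `|f| * `|g|.
Proof.
apply: dilation_le_norm => s; apply: le_trans (cnormM _ _) _.
by apply: ler_pM => //; exact: dilation_norm_le.
Qed.

(** The supremum of the squares is the square of the supremum. *)
Lemma pointwise_norm_star f : `|pointwise_mul (pointwise_star f) f| = `|f| ^+ 2.
Proof.
apply/eqP; rewrite eq_le; apply/andP; split.
  apply: dilation_le_norm => s; rewrite cnorm_star.
  by rewrite ler_pXn2r ?nnegrE//; exact: dilation_norm_le.
have q0 : 0 <= sqrtc `|pointwise_mul (pointwise_star f) f| by rewrite sqrtc_ge0.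
rewrite -[leRHS]sqr_sqrtc ler_pXn2r ?nnegrE//.
apply: dilation_le_norm => s.
rewrite -(ler_pXn2r (n := 2)) ?nnegrE// sqr_sqrtc -cnorm_star.
exact: (dilation_norm_le (pointwise_mul (pointwise_star f) f)).
Qed.

HB.instance Definition _ := isUnitalCStarAlgebra.Build R (dilation S A T)
  pointwise_mulA pointwise_mul1x pointwise_mulx1 pointwise_mulDl pointwise_mulDr
  pointwise_scaleAl pointwise_scaleAr pointwise_starK pointwise_starD
  pointwise_starZ pointwise_starM
  pointwise_normM pointwise_norm_star.

End PointwiseAlgebra.

(** * Ordered products over finite unions of intervals *)

Lemma seq_pair_ind (T : Type) (P : seq T -> Prop) :
  P [::] -> (forall a, P [:: a]) -> (forall a b s, P s -> P [:: a, b & s]) ->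
  forall s, P s.
Proof.
move=> P0 P1 P2; fix IH 1 => -[|a [|b s]].
- exact: P0.
- exact: P1.
- exact/P2/IH.
Qed.

Section OrderedInsertion.
Context {d : Order.disp_t} {T : orderType d}.
Implicit Types (u v a b : T) (s t : seq T).

Fixpoint insert u s :=
  if s is a :: t then if (u <= a)%O then u :: s else a :: insert u t else [:: u].

Lemma insert_perm u s : perm_eq (insert u s) (u :: s).
Proof.
elim: s => //= a t IH; case: ifP => // _.
by apply/permP => p /=; rewrite (permP IH) /=; ring.
Qed.

Lemma insert_sorted u s : sorted <=%O s -> sorted <=%O (insert u s).
Proof.
elim: s => //= a t IH at_; case: leP => [ua|au] /=; first by rewrite ua.
move: at_; rewrite !(path_sortedE le_trans).
move=> /andP[at_ st]; rewrite IH// andbT.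
by rewrite (perm_all _ (insert_perm u t)) /= ltW.
Qed.

Lemma sort_cons u s : sort <=%O (u :: s) = insert u (sort <=%O s).
Proof.
apply: (sorted_eq le_trans le_anti).
- exact/sort_sorted/le_total.
- exact/insert_sorted/sort_sorted/le_total.
rewrite perm_sort perm_sym; apply: perm_trans (insert_perm _ _) _.
by rewrite perm_cons perm_sort.
Qed.

Lemma insert_head u s : path <=%O u s -> insert u s = u :: s.
Proof. by case: s => //= a s /andP[->]. Qed.

End OrderedInsertion.

(** Divisibility, contractivity and geometric growth, with the operator norm
    unfolded and the length function taking its values in [K].  Of the continuity
    of the length function only the behaviour near the diagonal is kept. *)
Record growing_system {d : Order.disp_t} {T : orderTopologicalType d}
    {K : numFieldType} {V : normedModType K}
    (phi : T -> T -> {linear V -> V}) (L : T -> T -> K) : Prop := {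
  gs_id : forall u x, phi u u x = x;
  gs_comp : forall u v w x, (u <= v)%O -> (v <= w)%O ->
    phi u w x = phi u v (phi v w x);
  gs_contraction : forall u v x, (u <= v)%O -> `|phi u v x| <= `|x|;
  gs_growth : forall u v x, (u <= v)%O -> `|phi u v x - x| <= L u v * `|x|;
  gs_ge0 : forall u v, (u <= v)%O -> 0 <= L u v;
  gs_superadditive : forall u v w, (u <= v)%O -> (v <= w)%O ->
    L u v + L v w <= L u w;
  gs_continuous : forall u (e : K), 0 < e -> \forall v \near u,
    ((u <= v)%O -> L u v <= e) /\ ((v <= u)%O -> L v u <= e) }.

Section OrderedProduct.
Context {d : Order.disp_t} {T : orderTopologicalType d}
  {K : numFieldType} {V : normedModType K}
  {phi : T -> T -> {linear V -> V}} {L : T -> T -> K}.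
Hypothesis H : growing_system phi L.
Implicit Types (u v w a b : T) (s t : seq T) (x y : V).

(** For sorted [s = [:: a1; b1; a2; b2; ...]] this is the time-ordered product of
    [phi] over the intervals [[a1, b1)], [[a2, b2)], and so on. *)
Fixpoint ordered_product s x :=
  if s is a :: (b :: s') then phi a b (ordered_product s' x) else x.

Lemma ordered_product_linear s : linear (ordered_product s).
Proof.
move=> c x y; elim/seq_pair_ind: s => //= a b s ->; exact: linearP.
Qed.

Lemma ordered_product_ind (P : V -> Prop) s x :
  (forall u v y, (u <= v)%O -> P y -> P (phi u v y)) ->
  sorted <=%O s -> P x -> P (ordered_product s x).
Proof.
move=> Pphi; elim/seq_pair_ind: s => //= a b s IH /andP[ab /path_sorted st] Px.
exact/Pphi/IH.
Qed.

Lemma ordered_product_contraction s x : sorted <=%O s ->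
  `|ordered_product s x| <= `|x|.
Proof.
move=> st; apply: (ordered_product_ind (P := fun y => `|y| <= `|x|)) => // u v y uv.
exact/le_trans/(gs_contraction H).
Qed.

(** The estimate below does not distinguish whether the toggled point lies to the
    left or to the right of its partner [a]. *)
Definition pair_map u a y := if (u <= a)%O then phi u a y else phi a u y.

Lemma pair_map_dist u v a y : (u <= v)%O ->
  `|pair_map u a y - pair_map v a y| <= L u v * `|y|.
Proof.
move=> uv; rewrite /pair_map.
have [va|av] := leP v a.
  rewrite (le_trans uv va) (gs_comp H y uv va).
  apply: le_trans (gs_growth H _ uv) _.
  by rewrite ler_wpM2l ?(gs_ge0 H)// (gs_contraction H).
have [ua|au] := leP u a.
  rewrite -[phi u a y](subrK y) -addrA; apply: le_trans (ler_normD _ _) _.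
  rewrite (distrC y); apply: le_trans (_ : (L u a + L a v) * `|y| <= _).
    by rewrite mulrDl lerD// (gs_growth H)// ltW.
  by rewrite ler_wpM2r// (gs_superadditive H)// ltW.
rewrite (gs_comp H y (ltW au) uv) -linearB.
apply: le_trans (gs_contraction H _ (ltW au)) _.
by rewrite distrC; exact: gs_growth.
Qed.

Lemma insert_pair_low u a b s x : (u <= b)%O ->
  ordered_product (insert u [:: a, b & s]) x =
  pair_map u a (ordered_product (b :: s) x).
Proof. by rewrite /= /pair_map => ub; case: ifP => //= _; rewrite ub. Qed.

Lemma insert_pair_high u a b s x : (a <= b)%O -> path <=%O b s -> (b <= u)%O ->
  ordered_product (insert u [:: a, b & s]) x =
  phi a b (ordered_product (insert u s) x).
Proof.
move=> ab bs; rewrite le_eqVlt => /predU1P[<-|bu].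
  rewrite insert_pair_low// /pair_map insert_head//.
  by have [ba|//] := leP b a; rewrite (_ : a = b)//; apply/le_anti/andP.
by rewrite /= !leNgt (le_lt_trans ab bu) bu.
Qed.

(** The heart of the matter: toggling the membership of [[u, v)] changes the
    ordered product by at most the length of [[u, v)].  The interval is cut at the
    points of [t] inside it, each piece costs at most its own length, and
    superadditivity makes the total at most [L u v].  The induction removes one
    interval [[a, b)] of [t] at a time, cutting at [b]. *)
Lemma insert_dist t u v x : sorted <=%O t -> odd (size t) -> (u <= v)%O ->
  `|ordered_product (insert u t) x - ordered_product (insert v t) x| <=
  L u v * `|x|.
Proof.
elim/seq_pair_ind: t u v => // [a u v _ _ uv|a b t IH u v].
  by have := pair_map_dist a x uv; rewrite /pair_map /=; do 2 case: ifP => _.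
rewrite [sorted _ _]/= [odd _]/= negbK => /andP[ab bt] ot uv.
have st := path_sorted bt.
have low w1 w2 : (w1 <= w2)%O -> (w2 <= b)%O ->
    `|ordered_product (insert w1 [:: a, b & t]) x -
      ordered_product (insert w2 [:: a, b & t]) x| <= L w1 w2 * `|x|.
  move=> w12 w2b; rewrite !insert_pair_low//; last exact: le_trans w2b.
  apply: le_trans (pair_map_dist _ _ w12) _.
  rewrite ler_wpM2l ?(gs_ge0 H)//; exact: ordered_product_contraction.
have high w1 w2 : (w1 <= w2)%O -> (b <= w1)%O ->
    `|ordered_product (insert w1 [:: a, b & t]) x -
      ordered_product (insert w2 [:: a, b & t]) x| <= L w1 w2 * `|x|.
  move=> w12 bw1; rewrite !insert_pair_high//; last exact: le_trans w12.
  rewrite -linearB; apply: le_trans (gs_contraction H _ ab) _.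
  exact: IH.
have [vb|/ltW bv] := leP v b; first exact: low.
have [ub|/ltW bu] := leP u b; last exact: high.
pose m := ordered_product (insert b [:: a, b & t]) x.
rewrite -[X in X - _](subrK m) -addrA; apply: le_trans (ler_normD _ _) _.
apply: le_trans (lerD (low _ _ ub (lexx b)) (high _ _ bv (lexx b))) _.
by rewrite -mulrDl ler_wpM2r// (gs_superadditive H).
Qed.

(** A repeated point is either an empty interval, where [phi u u] is the identity,
    or a cut of an interval, where divisibility applies. *)
Lemma insert_twice u s x : sorted <=%O s -> ~~ odd (size s) ->
  ordered_product (insert u (insert u s)) x = ordered_product s x.
Proof.
elim/seq_pair_ind: s => //= [_ _|a b s IH /andP[ab bs]].
  by rewrite lexx/= (gs_id H).
rewrite negbK => es; have [ua|au] /= := leP u a.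
  by rewrite lexx /= (gs_id H).
have [ub|bu] /= := leP u b; rewrite (leNgt u a) au/=.
  by rewrite lexx/= -(gs_comp H)// ltW.
by rewrite (leNgt u b) bu/= IH// (path_sorted bs).
Qed.

(** The flips preserve the parity of [size s], so the values at unbounded sets,
    given by sequences of odd size, do not interact with the others and may be
    chosen constant. *)
Definition dilate_fun x s : V :=
  if odd (size s) then x else ordered_product (sort <=%O s) x.

Lemma dilate_fun_linear s : linear (dilate_fun^~ s).
Proof.
move=> c x y; rewrite /dilate_fun.
by case: ifP => // _; exact: ordered_product_linear.
Qed.

Lemma dilate_fun_norm x s : `|dilate_fun x s| <= `|x|.
Proof.
rewrite /dilate_fun; case: ifP => // _.
exact/ordered_product_contraction/sort_sorted/le_total.
Qed.

Lemma dilate_fun_dist u v x s : (u <= v)%O ->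
  `|dilate_fun x (u :: s) - dilate_fun x (v :: s)| <= L u v * `|x|.
Proof.
move=> uv; rewrite /dilate_fun /=; have [os|es] /= := boolP (odd (size s)).
  rewrite !sort_cons; apply: insert_dist => //; last by rewrite size_sort.
  exact/sort_sorted/le_total.
by rewrite subrr normr0 mulr_ge0// (gs_ge0 H).
Qed.

Lemma dilate_admissible x : dilate_fun x \in admissible V T.
Proof.
apply/admissibleP; split=> [||u e e0].
- by exists `|x| => s; exact: dilate_fun_norm.
- split=> [s t st|u s]; rewrite /dilate_fun.
    by rewrite (perm_size st) (perm_sortP le_total le_trans le_anti _ _ st).
  rewrite /= negbK; case: ifPn => // es; rewrite !sort_cons insert_twice//.
    exact/sort_sorted/le_total.
  by rewrite size_sort.
have c0 : 0 < `|x| + 1 by rewrite ltr_wpDl.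
have e1 : 0 < e / (`|x| + 1) by rewrite divr_gt0.
have le_e : e / (`|x| + 1) * `|x| <= e.
  by rewrite mulrAC ler_pdivrMr// ler_wpM2l ?lerDl ?ler01// ltW.
have := gs_continuous H u e1; apply: filterS => v [uv vu] s.
apply: le_trans le_e; have [le|/ltW le] := leP u v.
  rewrite distrC; apply: le_trans (dilate_fun_dist _ _ le) _.
  by rewrite ler_wpM2r// uv.
by apply: le_trans (dilate_fun_dist _ _ le) _; rewrite ler_wpM2r// vu.
Qed.

End OrderedProduct.

Section Dilate.
Context {d : Order.disp_t} {T : orderTopologicalType d}
  {R : realType} {K : numFieldType} {S : real_scalars R K}
  {V : completeNormedModType K}
  {phi : T -> T -> {linear V -> V}} {L : T -> T -> K}.
Hypothesis H : growing_system phi L.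

Definition dilate (x : V) : dilation S V T := Dilation S (dilate_admissible H x).

Lemma dilate_is_linear : linear dilate.
Proof.
by move=> c x y; apply: dilation_ext => s; exact: dilate_fun_linear.
Qed.

HB.instance Definition _ := GRing.isLinear.Build K V (dilation S V T) *:%R
  dilate dilate_is_linear.

Lemma eval0_dilate x : eval0 (dilate x) = x.
Proof. by []. Qed.

Lemma norm_dilate x : `|dilate x| = `|x|.
Proof.
apply/eqP; rewrite eq_le; apply/andP; split.
  apply: dilation_le_norm => s; exact: (dilate_fun_norm H).
exact: (dilation_norm_le (dilate x) [::]).
Qed.

Lemma eval0_flip_dilate u v x : (u <= v)%O ->
  eval0 (flip u v (dilate x)) = phi u v x.
Proof.
by move=> uv; rewrite /eval0 /= /dilate_fun sort_cons /= uv.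
Qed.

End Dilate.

(** * The dilation theorem *)

Definition real_real_scalars (R : realType) : real_scalars R R.
Proof. by refine (@RealScalars R R idfun idfun _ _ _ _). Defined.

Definition complex_real_scalars (R : realType) : real_scalars R R[i].
Proof.
refine (@RealScalars R R[i] (@complex.Re R) (real_complex R) _ _ _ _).
- by move=> x y; rewrite lecE => /andP[].
- by move=> x y; rewrite lecR.
- by move=> x x0; rewrite RRe_real// ger0_real.
- exact: rmorphD.
Defined.

Section GrowingSystem.
Context {d : Order.disp_t} {T : orderTopologicalType d}
  {R : realType} {K : numFieldType} (S : real_scalars R K)
  {V : completeNormedModType K} {phi : T -> T -> {linear V -> V}}.

Lemma remb0 : remb S 0 = 0.
Proof. by apply: (addrI (remb S 0)); rewrite -rembD !addr0. Qed.

Lemma rpart_gt0 (e : K) : 0 < e -> 0 < rpart S e.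
Proof.
move=> e0; rewrite ltNge; apply/negP => /(remb_le S).
by rewrite remb0 (rpartK S (ltW e0)) => /le_lt_trans/(_ e0); rewrite ltxx.
Qed.

Lemma opnorm_bound (u v : T) (l : R) x : (forall y, `|phi u v y| <= `|y|) ->
  opnorm (rpart S) (phi u v \- idfun) <= l -> `|phi u v x - x| <= remb S l * `|x|.
Proof.
move=> contr op; have [->|x0] := eqVneq x 0.
  by rewrite linear0 subrr normr0 mulr0.
have nx : 0 < `|x| by rewrite normr_gt0.
pose y := `|x|^-1 *: x.
have y1 : `|y| <= 1.
  by rewrite normrZ ger0_norm ?invr_ge0// mulVf// gt_eqF.
have : rpart S `|phi u v y - y| <= l.
  apply: le_trans op; apply: ub_le_sup; last by exists y.
  exists (rpart S 2) => _ [z z1 <-]; apply: rpart_le => /=.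
  apply: le_trans (ler_normB _ _) _.
  by rewrite (_ : 2 = 1 + 1)// lerD// (le_trans (contr z)).
move=> /(remb_le S); rewrite rpartK// => h.
have -> : phi u v x - x = `|x| *: (phi u v y - y).
  by rewrite linearZ/= -scalerBr scalerA mulfV ?gt_eqF// scale1r.
by rewrite normrZ normr_id mulrC ler_wpM2r.
Qed.

(** Near the diagonal, the length function is small because it is continuous and
    vanishes on the diagonal. *)
Lemma growing_systemP : divisible_system (le_edges T) phi ->
  (forall u v, le_edges T (u, v) -> linear_contraction (phi u v)) ->
  geometric_growth (le_edges T) (rpart S) phi ->
  exists L : T -> T -> K, growing_system phi L.
Proof.
move=> [_ did dcomp] contr [l [l0 lc luu lsup] lop].
exists (fun u v => remb S (l u v)); split.
- by move=> u x; apply: did; exact: lexx.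
- move=> u v w x uv vw; apply: dcomp => //; exact: le_trans vw.
- by move=> u v x uv; exact: contr.
- move=> u v x uv; apply: opnorm_bound; [exact: contr | exact: lop].
- by move=> u v uv; rewrite -remb0; apply/remb_le/l0.
- move=> u v w uv vw; rewrite -rembD; apply/remb_le/lsup => //; exact: le_trans vw.
move=> u e e0; have re0 := rpart_gt0 e0.
have /(_ (u, u) (lexx u)) := (subspace_continuousP _ _).1 lc.
move=> /cvgrPdist_le/(_ _ re0) [[B C] [/= uB uC] BC].
have Bu := nbhs_singleton uB; have Cu := nbhs_singleton uC.
have le_e v w : B v -> C w -> (v <= w)%O -> remb S (l v w) <= e.
  move=> Bv Cw vw; have : `|l u u - l v w| <= rpart S e := BC (v, w) (conj Bv Cw) vw.
  rewrite luu ?sub0r ?normrN; last exact: lexx.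
  rewrite ger0_norm ?l0// => /(remb_le S); rewrite rpartK// ltW//.
by apply: filterS2 uB uC => v Bv Cv; split; exact: le_e.
Qed.

End GrowingSystem.

Section IsometricDilation.
Context {d : Order.disp_t} {T : orderTopologicalType d}
  {R : realType} {K : numFieldType} (S : real_scalars R K).

Lemma isometric_dilation (V : completeNormedModType K)
    (phi : T -> T -> {linear V -> V}) (L : T -> T -> K) :
  growing_system phi L ->
  exists (V' : completeNormedModType K)
      (U : T -> T -> {linear V' -> V'})
      (j : {linear V' -> V}) (r : {linear V -> V'}),
      [/\ [/\ divisible_system (le_edges T) U,
              strongly_continuous (le_edges T) U
            & forall u v, le_edges T (u, v) ->
                norm_preserving (U u v) /\ surjective_op (U u v)],
          linear_contraction j /\ surjective_op j,
          norm_preserving r,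
          j \o r =1 id
        & forall u v, le_edges T (u, v) ->
            j \o U u v \o r =1 phi u v].
Proof.
move=> H; exists (dilation S V T), (fun u v => flip u v : {linear _ -> _}),
  (eval0 : {linear _ -> _}), (dilate H : {linear _ -> _}).
split.
- split; first split.
  + by move=> u v _; exists 1 => f; rewrite mul1r flip_norm.
  + by move=> u _ f; exact: flip_id.
  + by move=> u v w _ _ _ f; exact: flip_comp.
  + exact: flip_strongly_continuous.
  + move=> u v _; split=> f; first exact: flip_norm.
    by exists (flip u v f); exact: flip_involutive.
- split=> [f|x]; first exact: dilation_norm_le.
  by exists (dilate H x).
- by move=> x; exact: norm_dilate.
- by move=> x; exact: eval0_dilate.
- by move=> u v uv x; exact: eval0_flip_dilate.
Qed.

End IsometricDilation.

Section CStarDilation.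
Context {d : Order.disp_t} {T : orderTopologicalType d}
  {R : realType} {S : real_scalars R R[i]} {A : cstarAlgType R}.
Implicit Types (f : dilation S A T) (s : seq T).

Definition chosen_inverse (a : A) : A := xget 0 [set b | inverse_pair a b].

Lemma chosen_inverseP (a : A) :
  invertible a -> inverse_pair a (chosen_inverse a).
Proof.
by move=> [b ab]; rewrite /chosen_inverse; case: xgetP => [c _ ac//|/(_ b)].
Qed.

(** Pointwise inverses of [z *: cone - f] form an element of the algebra: they are
    uniformly bounded by the bound on positive elements, and hence inherit the
    continuity of [f] by the resolvent identity. *)
Lemma dilation_positive f : (forall s, positive_element (f s)) ->
  positive_element f.
Proof.
move=> pf; split.
  by apply: dilation_ext => s; exact: (pf s).1.
move=> z /= sz; have [//|z0] := boolP (0 <= z); case: sz.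
have inv s : invertible (z *: cone - f s).
  by apply: contrapT => /(pf s).2; exact/negP.
have [M MP] := positive_resolvent_uniform (A := A) z0.
pose g s := chosen_inverse (z *: cone - f s).
have gP s : inverse_pair (z *: cone - f s) (g s) by exact: chosen_inverseP.
have gM s : `|g s| <= M%:C%C by rewrite rnormE lecR; exact: MP (pf s) (gP s).
have M0 : 0 <= M%:C%C by exact: le_trans (gM [::]).
have gadm : g \in admissible A T.
  apply/admissibleP; split=> [||u e e0].
  - by exists M%:C%C.
  - split=> [s t st|u s]; rewrite /g; first by rewrite (dilation_perm f st).
    by rewrite dilation_cancel.
  - have c0 : 0 < M%:C%C * M%:C%C + 1 by rewrite ltr_wpDl// mulr_ge0.
    have e1 : 0 < e / (M%:C%C * M%:C%C + 1) by rewrite divr_gt0.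
    have := dilation_cont f u e1; apply: filterS => v fv s.
    rewrite (resolvent_identity (gP _) (gP _)).
    have -> : z *: cone - f (u :: s) - (z *: cone - f (v :: s)) =
        f (v :: s) - f (u :: s).
      by rewrite opprB addrC addrA subrK.
    apply: le_trans (cnormM _ _) _.
    apply: le_trans (_ : M%:C%C * (e / (M%:C%C * M%:C%C + 1) * M%:C%C) <= _).
      apply: ler_pM => //; apply: le_trans (cnormM _ _) _.
      by apply: ler_pM.
    rewrite mulrCA mulrAC ler_pdivrMr// ler_wpM2l//; first exact: ltW.
    by rewrite lerDl ler01.
exists (Dilation S gadm); split; apply: dilation_ext => s.
  by have [] := gP s.
by have [] := gP s.
Qed.

Lemma cstar_dilation
    (phi : T -> T -> {linear A -> A}) (L : T -> T -> R[i]) :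
  growing_system phi L ->
  (forall u v, le_edges T (u, v) ->
       positive_map (phi u v) /\ unital_map (phi u v)) ->
    exists (A' : cstarAlgType R)
      (U : T -> T -> {linear A' -> A'})
      (j : {linear A' -> A}) (r : {linear A -> A'}),
      [/\ (commutative_algebra A -> commutative_algebra A'),
          [/\ divisible_system (le_edges T) U,
              strongly_continuous (le_edges T) U
            & forall u v, le_edges T (u, v) -> star_automorphism (U u v)],
          unital_star_homomorphism j /\ surjective_op j,
          [/\ norm_preserving r, positive_map r & unital_map r]
        & j \o r =1 id /\
          forall u v, le_edges T (u, v) ->
            j \o U u v \o r =1 phi u v].
Proof.
move=> H pu; exists (dilation S A T), (fun u v => flip u v : {linear _ -> _}),
  (eval0 : {linear _ -> _}), (dilate H : {linear _ -> _}).
split.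
- by move=> com f g; apply: dilation_ext => s; exact: com.
- split; first split.
  + by move=> u v _; exists 1 => f; rewrite mul1r flip_norm.
  + by move=> u _ f; exact: flip_id.
  + by move=> u v w _ _ _ f; exact: flip_comp.
  + exact: flip_strongly_continuous.
  + move=> u v _; split; first by exists (flip u v); exact: flip_involutive.
    by split=> [|f g|f]; exact: dilation_ext.
- split; first by split.
  by move=> x; exists (dilate H x).
- split.
  + by move=> x; exact: norm_dilate.
  + move=> a pa; apply: dilation_positive => s /=; rewrite /dilate_fun.
    case: ifP => // _; apply: ordered_product_ind => //; last first.
      exact/sort_sorted/le_total.
    by move=> u v y uv; exact: (pu u v uv).1.
  + apply: dilation_ext => s /=; rewrite /dilate_fun.
    case: ifP => // _; apply: (ordered_product_ind (P := fun y => y = cone)) => //.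
      by move=> u v _ uv ->; exact: (pu u v uv).2.
    exact/sort_sorted/le_total.
- split; first by move=> x; exact: eval0_dilate.
  by move=> u v uv x; exact: eval0_flip_dilate.
Qed.

End CStarDilation.

Theorem theorem1p8 (R : realType) (d : Order.disp_t)
    (Omega : orderTopologicalType d) (hG : is_graph (le_edges Omega)) :
  (forall (K : numFieldType) (re : K -> R), scalar_field re ->
   forall (V : completeNormedModType K)
      (phi : Omega -> Omega -> {linear V -> V}),
    divisible_system (le_edges Omega) phi ->
    (forall u v, le_edges Omega (u, v) -> linear_contraction (phi u v)) ->
    geometric_growth (le_edges Omega) re phi ->
    exists (V' : completeNormedModType K)
      (U : Omega -> Omega -> {linear V' -> V'})
      (j : {linear V' -> V}) (r : {linear V -> V'}),
      [/\ [/\ divisible_system (le_edges Omega) U,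
              strongly_continuous (le_edges Omega) U
            & forall u v, le_edges Omega (u, v) ->
                norm_preserving (U u v) /\ surjective_op (U u v)],
          linear_contraction j /\ surjective_op j,
          norm_preserving r,
          j \o r =1 id
        & forall u v, le_edges Omega (u, v) ->
            j \o U u v \o r =1 phi u v])
  /\
  (forall (A : cstarAlgType R) (phi : Omega -> Omega -> {linear A -> A}),
    divisible_system (le_edges Omega) phi ->
    (forall u v, le_edges Omega (u, v) -> linear_contraction (phi u v)) ->
    geometric_growth (le_edges Omega) (@complex.Re R) phi ->
    (forall u v, le_edges Omega (u, v) ->
       positive_map (phi u v) /\ unital_map (phi u v)) ->
    exists (A' : cstarAlgType R)
      (U : Omega -> Omega -> {linear A' -> A'})
      (j : {linear A' -> A}) (r : {linear A -> A'}),
      [/\ (commutative_algebra A -> commutative_algebra A'),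
          [/\ divisible_system (le_edges Omega) U,
              strongly_continuous (le_edges Omega) U
            & forall u v, le_edges Omega (u, v) -> star_automorphism (U u v)],
          unital_star_homomorphism j /\ surjective_op j,
          [/\ norm_preserving r, positive_map r & unital_map r]
        & j \o r =1 id /\
          forall u v, le_edges Omega (u, v) ->
            j \o U u v \o r =1 phi u v]).
Proof.
split.
  move=> K re [] V phi dphi contr growth.
    have [L HL] := growing_systemP (S := real_real_scalars R) dphi contr growth.
    exact: isometric_dilation (real_real_scalars R) _ _ _ HL.
  have [L HL] := growing_systemP (S := complex_real_scalars R) dphi contr growth.
  exact: isometric_dilation (complex_real_scalars R) _ _ _ HL.
move=> A phi dphi contr growth pu.
have [L HL] := growing_systemP (S := complex_real_scalars R) dphi contr growth.
exact: (cstar_dilation (S := complex_real_scalars R) HL pu).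
Qed.
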